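(* Let $n,t,\ell$ be positive integers, $k, k'$ non-negative integers, $\epsilon\ge 0$, and let $f\colon \mathbb{F}_2^n \times \mathbb{F}_2^t \to \mathbb{F}_2^\ell$ be a strong $k \to_\epsilon k'$ condenser. Put $K := 2^k$, $K' := 2^{k'}$, $L := 2^\ell$, $N := 2^n$, $T := 2^t$, $M := TL$. Suppose that real parameters $p, \nu, \gamma > 0$ satisfy \[ (p + \gamma)\frac{L}{K'} + \frac{\nu}{\gamma} < 1 - \epsilon, \] and that $D := \gamma L$ (an integer). Then the $M\times N$ adjacency matrix $\mathcal{M}$ of the codeword graph of $f$ is $\left(p M , (\nu/D)M, K-D, 0\right)$-correcting for $D$-sparse vectors. Moreover, there is an algorithm that, given any $\hat y\in\mathbb{F}_2^M$, outputs a valid decoding of $\hat y$ (with respect to these parameters) in time $O(MN)$.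
   Context: Min-entropy of a distribution $\mathcal{X}$ on a finite set: $H_\infty(\mathcal{X})=\min_x\{-\log_2 \Pr_{\mathcal{X}}(x)\}$ over its support. Two distributions on the same finite set are $\epsilon$-close if their statistical distance $\frac12\sum_s|\Pr_{\mathcal{X}}(s)-\Pr_{\mathcal{Y}}(s)|$ is at most $\epsilon$. $\mathcal{U}_t$ is the uniform distribution on $\mathbb{F}_2^t$. A function $f\colon \mathbb{F}_2^n\times\mathbb{F}_2^t\to\mathbb{F}_2^\ell$ is a strong $k\to_\epsilon k'$ condenser if for every distribution $\mathcal{X}$ on $\mathbb{F}_2^n$ with min-entropy at least $k$, with $X\sim\mathcal{X}$ and independent seed $Y\sim\mathcal{U}_t$, the distribution of $(Y,f(X,Y))$ is $\epsilon$-close to some distribution of the form $(\mathcal{U}_t,\mathcal{Z})$ with min-entropy at least $t+k'$. Codeword graph / adjacency matrix: the rows are indexed by pairs $(i,\sigma)\in\mathbb{F}_2^t\times\mathbb{F}_2^\ell$ (so there are $TL$ rows), the columns by $x\in\mathbb{F}_2^n$ (so $N$ columns), and the entry in row $(i,\sigma)$ and column $x$ is $1$ iff $f(x,i)=\sigma$ (i.e., $x$ is identified with the codeword $(f(x,i))_{i\in\mathbb{F}_2^t}$ of the code induced by $f$, adjacent to the right vertices $(i,f(x,i))$). A vector is $D$-sparse if it has at most $D$ nonzero coordinates. For an $M\times N$ binary matrix $A$ and $x\in\mathbb{F}_2^N$, $A[x]\in\mathbb{F}_2^M$ is the bitwise OR of the columns of $A$ indexed by the support of $x$. For non-negative reals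 $e_0,e_1$, an ordered pair $(x,y)$ of binary vectors of the same length is $(e_0,e_1)$-close if $y$ can be obtained from $x$ by flipping at most $e_0$ bits from $0$ to $1$ and at most $e_1$ bits from $1$ to $0$; otherwise it is $(e_0,e_1)$-far. $A$ is $(e_0,e_1,e'_0,e'_1)$-correcting for $D$-sparse vectors if for every $y\in\mathbb{F}_2^M$ there exists $z\in\mathbb{F}_2^N$ (a valid decoding of $y$) such that for every $D$-sparse $x\in\mathbb{F}_2^N$, whenever $(x,z)$ is $(e'_0,e'_1)$-far, $(A[x],y)$ is $(e_0,e_1)$-far.
   Formalization: The hypothesis k ≤ n is added: for k > n every f is vacuously a strong condenser and the claim fails (e.g. n=1, k=2, t=ℓ=1, k'=10, ε=0, f constant, γ=2, D=4, p=1, ν=1/2). *)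

(* Defs.v *)
From HB Require Import structures.
From mathcomp Require Import all_boot all_order all_algebra.
From mathcomp Require Import all_classical all_reals all_analysis.

Set Implicit Arguments.
Unset Strict Implicit.
Unset Printing Implicit Defensive.

Import Order.TTheory GRing.Theory Num.Theory.
Local Open Scope ring_scope.

(** * Distributions on finite sets *)

Section Distributions.
Context {R : realType}.

Definition is_dist (A : finType) (P : {ffun A -> R}) : Prop :=
  (forall a, 0 <= P a) /\ \sum_a P a = 1.

Definition unif_dist (A : finType) : {ffun A -> R} := [ffun=> #|A|%:R^-1].

Definition indep_dist (A B : finType) (P : {ffun A -> R}) (Q : {ffun B -> R}) :
  {ffun A * B -> R} := [ffun ab => P ab.1 * Q ab.2].

(* law of g(a) for a distributed according to P *)
Definition push_dist (A B : finType) (g : A -> B) (P : {ffun A -> R}) :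
  {ffun B -> R} := [ffun b => \sum_(a | g a == b) P a].

Definition log2 (x : R) : R := ln x / ln 2.

(* The default value +oo is reached only when the support is empty, which does
   not happen for a distribution. *)
Definition min_entropy (A : finType) (P : {ffun A -> R}) : \bar R :=
  \big[Order.min/+oo%E]_(a | P a != 0) (- log2 (P a))%:E.

Definition stat_dist (A : finType) (P Q : {ffun A -> R}) : R :=
  2^-1 * \sum_a `|P a - Q a|.

(* The law Z of the pair (U_t, Z) is an arbitrary distribution whose first
   marginal is uniform; its second component may depend on the seed. *)
Definition strong_condenser (n t l k k' : nat) (eps : R)
    (f : 'rV['F_2]_n -> 'rV['F_2]_t -> 'rV['F_2]_l) : Prop :=
  forall X : {ffun 'rV['F_2]_n -> R},
    is_dist X -> (k%:R%:E <= min_entropy X)%E ->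
    exists Z : {ffun 'rV['F_2]_t * 'rV['F_2]_l -> R},
      [/\ is_dist Z,
          push_dist fst Z = unif_dist 'rV['F_2]_t,
          ((t + k')%:R%:E <= min_entropy Z)%E &
          stat_dist
            (push_dist (fun xy => (xy.2, f xy.1 xy.2))
                       (indep_dist X (unif_dist 'rV['F_2]_t)))
            Z <= eps].

End Distributions.

(** * Codeword graphs *)

Lemma card_F2vec n : #|{: 'rV['F_2]_n}| = (2 ^ n)%N.
Proof. by rewrite card_mx card_Fp // mul1n. Qed.

Lemma card_F2vec_pair t l :
  #|{: 'rV['F_2]_t * 'rV['F_2]_l}| = (2 ^ t * 2 ^ l)%N.
Proof. by rewrite card_prod !card_F2vec. Qed.

(* Enumerations of the column and row labels by ordinals, so that the adjacency
   matrix is a genuine M x N matrix. *)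
Definition col_label n (c : 'I_(2 ^ n)) : 'rV['F_2]_n :=
  enum_val (cast_ord (esym (card_F2vec n)) c).

Definition row_label t l (r : 'I_(2 ^ t * 2 ^ l)) :
  'rV['F_2]_t * 'rV['F_2]_l :=
  enum_val (cast_ord (esym (card_F2vec_pair t l)) r).

Definition codeword_mx (n t l : nat)
    (f : 'rV['F_2]_n -> 'rV['F_2]_t -> 'rV['F_2]_l) :
    'M['F_2]_(2 ^ t * 2 ^ l, 2 ^ n) :=
  \matrix_(r, c)
    (f (col_label c) (row_label r).1 == (row_label r).2)%:R.

(** * Disjunctive measurements and error correction *)

Definition sparse (D : nat) (N : nat) (x : 'rV['F_2]_N) : Prop :=
  (#|[set j | (x 0 j != 0)%R]| <= D)%N.

Definition or_mx (M N : nat) (A : 'M['F_2]_(M, N)) (x : 'rV['F_2]_N) :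
    'rV['F_2]_M :=
  \row_i ([exists j, (x 0 j != 0) && (A i j != 0)])%:R.

Section Correcting.
Context {R : realType}.

Definition bits_close (e0 e1 : R) (m : nat) (x y : 'rV['F_2]_m) : Prop :=
  (#|[set i | (x 0 i == 0) && (y 0 i == 1)]|%:R <= e0) /\
  (#|[set i | (x 0 i == 1) && (y 0 i == 0)]|%:R <= e1).

Definition bits_far (e0 e1 : R) (m : nat) (x y : 'rV['F_2]_m) : Prop :=
  ~ bits_close e0 e1 x y.

Definition valid_decoding (M N : nat) (A : 'M['F_2]_(M, N)) (D : nat)
    (e0 e1 e0' e1' : R) (y : 'rV['F_2]_M) (z : 'rV['F_2]_N) : Prop :=
  forall x : 'rV['F_2]_N, sparse D x ->
    bits_far e0' e1' x z -> bits_far e0 e1 (or_mx A x) y.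

Definition correcting (M N : nat) (A : 'M['F_2]_(M, N)) (D : nat)
    (e0 e1 e0' e1' : R) : Prop :=
  forall y : 'rV['F_2]_M, exists z : 'rV['F_2]_N,
    valid_decoding A D e0 e1 e0' e1' y z.

End Correcting.

(** * Random access machines *)

(* A unit-cost RAM with registers and an indirectly addressed memory, both
   holding natural numbers. Arithmetic is limited to +1 and -1: a value exceeds
   the inputs and program constants by at most the number of steps, so charging
   one unit
   per instruction does not hide computations on huge numbers. *)
Inductive ram_instr : Type :=
| IConst of nat & nat   (* IConst i c : reg[i] := c                *)
| IMove of nat & nat    (* IMove i j  : reg[i] := reg[j]           *)
| ISucc of nat          (* ISucc i    : reg[i] := reg[i] + 1       *)
| IPred of nat          (* IPred i    : reg[i] := max(reg[i]-1, 0) *)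
| ILoad of nat & nat    (* ILoad i j  : reg[i] := mem[reg[j]]      *)
| IStore of nat & nat   (* IStore i j : mem[reg[i]] := reg[j]      *)
| IJump of nat & nat.   (* IJump i q  : if reg[i] > 0 then goto q  *)

Definition ram_program := seq ram_instr.

Record ram_state := RamState {
  ram_pc : nat;
  ram_reg : nat -> nat;
  ram_mem : nat -> nat }.

Definition upd (g : nat -> nat) (a v : nat) : nat -> nat :=
  fun b => if b == a then v else g b.

Definition ram_exec (i : ram_instr) (s : ram_state) : ram_state :=
  let: RamState pc r m := s in
  match i with
  | IConst a c => RamState pc.+1 (upd r a c) m
  | IMove a b => RamState pc.+1 (upd r a (r b)) m
  | ISucc a => RamState pc.+1 (upd r a (r a).+1) m
  | IPred a => RamState pc.+1 (upd r a (r a).-1) m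
  | ILoad a b => RamState pc.+1 (upd r a (m (r b))) m
  | IStore a b => RamState pc.+1 r (upd m (r a) (r b))
  | IJump a q => RamState (if (0 < r a)%N then q else pc.+1) r m
  end.

(* The machine halts when the program counter leaves the program. *)
Definition ram_step (P : ram_program) (s : ram_state) : ram_state :=
  if onth P (ram_pc s) is Some i then ram_exec i s else s.

Definition ram_halted (P : ram_program) (s : ram_state) : Prop :=
  (size P <= ram_pc s)%N.

(* Address of the output buffer, just after y and the entries of the matrix. *)
Definition out_addr (M N : nat) : nat := (M + M * N)%N.

(* Initial state for decoding y. Memory holds y followed by the matrix, column
   by column, one bit per cell; registers 0, 1, 2, ... hold the dimensions, the
   sparsity, the error parameters and the output address. The numbers of flipped
   bits being integers, closeness for e0, e1 depends only on the integer parts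
   of e0 and e1, which are what the machine receives. *)
Definition decoder_input {R : realType} (M N : nat) (A : 'M['F_2]_(M, N))
    (D : nat) (e0 e1 e0' e1' : R) (y : 'rV['F_2]_M) : ram_state :=
  RamState 0
    (nth 0%N [:: M; N; D; Num.truncn e0; Num.truncn e1;
                 Num.truncn e0'; Num.truncn e1'; out_addr M N])
    (nth 0%N ([seq nat_of_ord (y 0 i) | i <- enum 'I_M]
              ++ [seq nat_of_ord (A i j) | j <- enum 'I_N, i <- enum 'I_M])).

Definition decoder_output (M N : nat) (s : ram_state) (z : 'rV['F_2]_N) : Prop :=
  forall j : 'I_N, ram_mem s (out_addr M N + j)%N = nat_of_ord (z 0 j).

Definition outputs_within (P : ram_program) (s0 : ram_state) (time : nat)
    (M N : nat) (z : 'rV['F_2]_N) : Prop :=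
  exists2 q : nat, (q <= time)%N &
    ram_halted P (iter q (ram_step P) s0) /\
    decoder_output M (iter q (ram_step P) s0) z.

(* Main.v *)
Require Import Defs.
From HB Require Import structures.
From mathcomp Require Import all_boot all_order all_algebra.
From mathcomp Require Import all_classical all_reals all_analysis.
From mathcomp Require Import zify lra.

Set Implicit Arguments.
Unset Strict Implicit.
Unset Printing Implicit Defensive.

Import Order.TTheory GRing.Theory Num.Theory.
Local Open Scope ring_scope.

(** The decoder keeps the set J of all columns c such that at most e1 of the
    ones of c face a zero of y. If (A[x], y) is (e0, e1)-close, every column of
    supp x is in J, so no 1 is lost. If |J \ supp x| > K - D, pad J to a set J'
    of at least K columns by adding at most D - |supp x| of them; this padding
    is what handles vectors x of weight less than D. Let B consist of the ones
    of y outside A[x] together with the ones of the columns in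
    supp x and J' \ J: it has at most (p + gamma) M elements and contains the
    support of y. For X uniform on J', (Y, f(X, Y)) falls in B with probability
    at least 1 - nu / gamma, whereas a source of min-entropy t + k' does so with
    probability at most |B| / (T K') <= (p + gamma) L / K', which contradicts
    the condenser property. *)

(** * Statistical tests, min-entropy and flat sources *)

Section Probability.
Context {R : realType}.

Definition prob (A : finType) (P : {ffun A -> R}) (B : {set A}) : R :=
  \sum_(a in B) P a.

Lemma prob_setC (A : finType) (P : {ffun A -> R}) (B : {set A}) :
  is_dist P -> prob P (~: B) = 1 - prob P B.
Proof.
case=> _ <-; rewrite /prob [in RHS](bigID (mem B)) /= addrC addrK.
by apply: eq_bigl => a; rewrite inE.
Qed.

(** Both total masses are 1, so [B] and its complement show the same gap up to sign. Each part of
    the sum bounds this gap, and averaging the two gives the factor 1/2. *)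
Lemma prob_sub_le_stat_dist (A : finType) (P Q : {ffun A -> R}) (B : {set A}) :
  is_dist P -> is_dist Q -> prob P B - prob Q B <= stat_dist P Q.
Proof.
move=> dP dQ.
have half (C : {set A}) : prob P C - prob Q C <= \sum_(a in C) `|P a - Q a|.
  by rewrite /prob -sumrB ler_sum // => a _; rewrite ler_norm.
have halfC : prob P B - prob Q B <= \sum_(a in ~: B) `|P a - Q a|.
  have -> : prob P B - prob Q B = prob Q (~: B) - prob P (~: B).
    by rewrite !prob_setC //; lra.
  rewrite /prob -sumrB ler_sum // => a _; rewrite distrC; exact: ler_norm.
rewrite /stat_dist (bigID (mem B)) /=.
rewrite [X in _ * (_ + X)](eq_bigl (mem (~: B))) => [|a]; last by rewrite !inE.
by have := half B; lra.
Qed.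

Lemma log2_exp2 (k : nat) : log2 (2 ^+ k : R) = k%:R.
Proof.
rewrite /log2 lnXn // -[X in X / _]mulr_natl mulfK //.
by rewrite gt_eqF // ln_gt0 // ltr1n.
Qed.

(** Replaces entropy by a pointwise bound; points outside the support satisfy it trivially. *)
Lemma le_min_entropyP (A : finType) (P : {ffun A -> R}) (k : nat) :
  (forall a, 0 <= P a) ->
  (k%:R%:E <= min_entropy P)%E <-> forall a, P a <= 2 ^- k.
Proof.
move=> P0.
have ln2 : 0 < ln 2 :> R by rewrite ln_gt0 // ltr1n.
have one a : P a != 0 -> (k%:R <= - log2 (P a)) = (P a <= 2 ^- k).
  move=> Pa0; have Pa : 0 < P a by rewrite lt_def Pa0 P0.
  have two : 0 < 2 ^- k :> R by rewrite invr_gt0 exprn_gt0.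
  rewrite -ler_ln // lnV ?posrE ?exprn_gt0 // lerNr -[k%:R](log2_exp2 k).
  by rewrite /log2 ler_pdivrMr // mulNr mulrVK // unitfE gt_eqF.
split=> [/bigmin_geP [_ h] a|h].
  have [->|Pa] := eqVneq (P a) 0; first by rewrite invr_ge0 exprn_ge0.
  by rewrite -one // -lee_fin h.
by apply/bigmin_geP; split=> [|a Pa]; rewrite ?leey // lee_fin one.
Qed.

Definition unif_on (A : finType) (S : {set A}) : {ffun A -> R} :=
  [ffun a => if a \in S then #|S|%:R^-1 else 0].

Lemma unif_on_ge0 (A : finType) (S : {set A}) a : 0 <= unif_on S a.
Proof. by rewrite ffunE; case: ifP => // _; rewrite invr_ge0. Qed.

Lemma unif_on_dist (A : finType) (S : {set A}) :
  (0 < #|S|)%N -> is_dist (unif_on S).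
Proof.
move=> S0; split; first exact: unif_on_ge0.
under eq_bigr => a _ do rewrite ffunE.
rewrite -big_mkcond sumr_const -[LHS]mulr_natl mulfV // pnatr_eq0.
by rewrite -lt0n.
Qed.

Lemma unif_on_min_entropy (A : finType) (S : {set A}) (k : nat) :
  (2 ^ k <= #|S|)%N -> (k%:R%:E <= min_entropy (unif_on S))%E.
Proof.
move=> kS; apply/(le_min_entropyP _ (unif_on_ge0 S)) => a; rewrite ffunE.
case: ifP => _; last by rewrite invr_ge0 exprn_ge0.
rewrite lef_pV2 ?posrE ?exprn_gt0 // -?natrX ?ler_nat // ltr0n.
by apply: leq_trans kS; rewrite expn_gt0.
Qed.

Lemma unif_dist_is_dist (A : finType) :
  (0 < #|A|)%N -> is_dist (@unif_dist R A).
Proof.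
move=> A0; split=> [a|]; first by rewrite ffunE invr_ge0.
under eq_bigr => a _ do rewrite ffunE.
by rewrite sumr_const -[LHS]mulr_natl mulfV // pnatr_eq0 -lt0n.
Qed.

Lemma indep_dist_is_dist (A B : finType)
    (P : {ffun A -> R}) (Q : {ffun B -> R}) :
  is_dist P -> is_dist Q -> is_dist (indep_dist P Q).
Proof.
move=> [P0 P1] [Q0 Q1]; split=> [ab|]; first by rewrite ffunE mulr_ge0.
under eq_bigr => ab _ do rewrite ffunE.
rewrite -(pair_bigA _ (fun a b => P a * Q b)) /=.
by under eq_bigr => a _ do rewrite -mulr_sumr Q1 mulr1.
Qed.

Lemma push_dist_prob (A B : finType) (g : A -> B) (P : {ffun A -> R})
    (C : {set B}) :
  prob (push_dist g P) C = prob P (g @^-1: C).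
Proof.
rewrite /prob (partition_big g (mem C)) => [|a]; last by rewrite inE.
apply: eq_bigr => b bC; rewrite ffunE; apply: eq_bigl => a.
by rewrite inE andbC; case: eqP => // ->.
Qed.

Lemma push_dist_is_dist (A B : finType) (g : A -> B) (P : {ffun A -> R}) :
  is_dist P -> is_dist (push_dist g P).
Proof.
move=> [P0 P1]; split=> [b|]; first by rewrite ffunE sumr_ge0.
have := push_dist_prob g P [set: B]; rewrite /prob.
under eq_bigl do rewrite inE.
by under [X in _ = X]eq_bigl do rewrite !inE; rewrite P1.
Qed.

Lemma prob_le_min_entropy (A : finType) (P : {ffun A -> R}) (k : nat)
    (B : {set A}) :
  is_dist P -> (k%:R%:E <= min_entropy P)%E -> prob P B <= #|B|%:R / 2 ^+ k.
Proof.
move=> [P0 _] /(le_min_entropyP _ P0) h.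
rewrite mulr_natl -sumr_const; exact: ler_sum.
Qed.

(* B is a statistical test: it catches (Y, f(X, Y)) with probability at least
   1 - delta, but a high min-entropy source only with probability
   #|B| / 2^(t + k'). *)
Lemma condenser_test (n t l k k' : nat) (eps delta : R)
    (f : 'rV['F_2]_n -> 'rV['F_2]_t -> 'rV['F_2]_l)
    (S : {set 'rV['F_2]_n}) (B : {set 'rV['F_2]_t * 'rV['F_2]_l}) :
  strong_condenser k k' eps f -> (2 ^ k <= #|S|)%N ->
  (forall x, x \in S ->
     #|[set i | (i, f x i) \notin B]|%:R <= delta * (2 ^ t)%:R) ->
  1 - delta - #|B|%:R / (2 ^ t * 2 ^ k')%:R <= eps.
Proof.
move=> fC kS SB.
have S0 : (0 < #|S|)%N by apply: leq_trans kS; rewrite expn_gt0.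
have dX := unif_on_dist S0.
have [Z [dZ _ hZ]] := fC _ dX (unif_on_min_entropy kS).
have T0 : (0 < #|{: 'rV['F_2]_t}|)%N by rewrite card_F2vec expn_gt0.
have dU := unif_dist_is_dist T0.
have dXU := indep_dist_is_dist dX dU.
set g := fun _ => _; set P := push_dist g _ => PZ.
have dP : is_dist P by exact: push_dist_is_dist.
apply: le_trans PZ; apply: le_trans (prob_sub_le_stat_dist B dP dZ).
apply: lerB; last first.
  by have := prob_le_min_entropy B dZ hZ; rewrite exprD -!natrX -natrM.
suff : prob P (~: B) <= delta by rewrite prob_setC //; lra.
rewrite push_dist_prob /prob.
(* Condition on the source value [x]: for [x] in [S] at most a [delta] fraction of the seeds leaves
   [B], and any other [x] has weight 0. *)
rewrite (partition_big fst xpredT) //=.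
apply: (@le_trans _ _ (\sum_x unif_on S x * delta)); last first.
  by rewrite -mulr_suml; case: dX => _ ->; rewrite mul1r.
apply: ler_sum => x _.
have [xS|xS] := boolP (x \in S); last first.
  rewrite big1 => [|[x' i] /andP[_ /eqP /= ->]].
    by rewrite ffunE (negPf xS) mul0r.
  by rewrite !ffunE /= (negPf xS) mul0r.
rewrite (reindex (pair x)) /=; last first.
  exists snd => [i|[x' i]] //; by rewrite inE /= => /andP[_ /eqP ->].
under eq_bigr => i _ do rewrite ffunE /= [unif_dist _ _]ffunE.
rewrite sumr_const -[leLHS]mulr_natl mulrCA ler_wpM2l ?unif_on_ge0 //.
rewrite card_F2vec ler_pdivrMr ?ltr0n ?expn_gt0 //.
apply: le_trans (SB x xS); rewrite ler_nat; apply: subset_leq_card.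
by apply/fintype.subsetP => i; rewrite inE => /andP[]; rewrite !inE.
Qed.

End Probability.

(* Registers: 1 columns left, 4 threshold plus one, 7 output address, 8 address
   in the matrix, 9 address in y, 10 remaining budget (0 once the column is
   rejected), 11 rows left, 12 scratch, 13 constant 1. *)
Definition threshold_program : ram_program :=
  [:: IConst 13 1;   (*  0 *)
      ISucc 4;
      IMove 8 0;
      IConst 9 0;    (*  3: next column *)
      IMove 10 4;
      IMove 11 0;
      ILoad 12 9;    (*  6: next row *)
      IJump 12 12;
      ILoad 12 8;
      IJump 12 11;
      IJump 13 12;
      IPred 10;      (* 11: entry 1 of the column facing an entry 0 of y *)
      ISucc 9;       (* 12 *)
      ISucc 8;
      IPred 11;
      IJump 11 6;
      IJump 10 19;   (* 16: end of the column *)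
      IStore 7 10;
      IJump 13 20;
      IStore 7 13;   (* 19 *)
      ISucc 7;       (* 20 *)
      IPred 1;
      IJump 1 3].

Local Notation step := (ram_step threshold_program).

(** * Correctness and running time of the machine loops *)

Section ThresholdProgram.
Local Open Scope nat_scope.

(** With y stored at [a] and a column at [b], this counts the 1-to-0 flips that the column would
    require. *)
Definition missed (m : nat -> nat) (a b c : nat) : nat :=
  \sum_(i < c) ((m (a + i) == 0) && (m (b + i) != 0)).

(** The three cases for the bits read take 6, 9 and 9 steps. The last clause lists the registers on
    which the enclosing loops rely. *)
Lemma row_step (r m : nat -> nat) : r 13 = 1 ->
  exists q r', [/\ q <= 9,
    iter q step (RamState 6 r m) =
      RamState (if 1 < r 11 then 6 else 16) r' m,
    [/\ r' 8 = (r 8).+1, r' 9 = (r 9).+1, r' 11 = (r 11).-1 &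
        r' 10 = r 10 - ((m (r 9) == 0) && (m (r 8) != 0))] &
    forall i, i \in [:: 0; 1; 4; 7; 13] -> r' i = r i].
Proof.
move=> r13.
have pc : forall x : nat, (0 < x.-1) = (1 < x) by case=> [|[]].
case y0: (m (r 9)) => [|v]; last first.
  exists 6; eexists; split; first by [].
  - by rewrite /= /ram_step /= /upd /= y0 /= pc.
  - by split; rewrite /upd //= subn0.
  - by move=> i; rewrite !inE => /or4P[|||/orP[]] /eqP ->.
case a0: (m (r 8)) => [|v].
  exists 9; eexists; split; first by [].
  - by rewrite /= /ram_step /= /upd /= y0 /= /upd /= a0 /= /upd /= r13 /= pc.
  - by split; rewrite /upd //= subn0.
  - by move=> i; rewrite !inE => /or4P[|||/orP[]] /eqP ->.
exists 9; eexists; split; first by [].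
- by rewrite /= /ram_step /= /upd /= y0 /= /upd /= a0 /= /upd /= pc.
- by split; rewrite /upd //= subn1.
- by move=> i; rewrite !inE => /or4P[|||/orP[]] /eqP ->.
Qed.

(** Truncated subtractions compose, [x - a - b = x - (a + b)], so register 10 ends positive exactly
    when the misses stay below the initial budget. *)
Lemma column_loop (c : nat) (r m : nat -> nat) :
  r 13 = 1 -> r 11 = c.+1 ->
  exists q r', [/\ q <= 9 * c.+1,
    iter q step (RamState 6 r m) = RamState 16 r' m,
    r' 8 = r 8 + c.+1,
    r' 10 = r 10 - missed m (r 9) (r 8) c.+1 &
    forall i, i \in [:: 0; 1; 4; 7; 13] -> r' i = r i].
Proof.
elim: c r => [|c IH] r r13 r11;
  have [q [r1 [qle run [r8 r9 r11' r10] fr]]] := row_step m r13.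
  exists q, r1; split=> //; first by rewrite run r11.
    by rewrite r8 addn1.
  by rewrite r10 /missed big_ord_recl big_ord0 !addn0.
rewrite r11 /= in r11' run.
have [] := IH r1 _ r11'; first by rewrite fr.
move=> q' [r2 [q'le run' r8' r10' fr']].
exists (q' + q), r2; split.
- by rewrite mulnS addnC leq_add.
- by rewrite iterD run.
- by rewrite r8' r8 addSnnS.
- rewrite r10' r10 r8 r9 -subnDA /missed [in RHS]big_ord_recl !addn0.
  by congr (_ - (_ + _)); apply: eq_bigr => i _; rewrite !addSnnS.
- by move=> i ii; rewrite fr' ?fr.
Qed.

(** Besides the rows, 3 instructions set up the column and at most 6 store its bit and advance,
    hence the extra 9. *)
Lemma column_step (r m : nat -> nat) : r 13 = 1 -> (0 < r 0) ->
  exists q r', [/\ (q <= 9 * r 0 + 9),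
    iter q step (RamState 3 r m) =
      RamState (if 1 < r 1 then 3 else 23) r'
        (upd m (r 7) (missed m 0 (r 8) (r 0) < r 4)),
    [/\ r' 1 = (r 1).-1, r' 7 = (r 7).+1 & r' 8 = (r 8 + r 0)] &
    forall i, i \in [:: 0; 4; 13] -> r' i = r i].
Proof.
move=> r13 r0.
pose r1 := upd (upd (upd r 9 0) 10 (r 4)) 11 (r 0).
have start : iter 3 step (RamState 3 r m) = RamState 6 r1 m by [].
have pc : forall x : nat, (0 < x.-1) = (1 < x) by case=> [|[]].
have [] := @column_loop (r 0).-1 r1 m; rewrite ?/r1 ?/upd /= ?prednK //.
rewrite -/(upd _ _ _) -/r1 => q [r2 [qle run r28 r210 fr]].
have r2_13 : r2 13 = 1 by rewrite fr.
have r2_7 : r2 7 = r 7 by rewrite fr.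
have r2_1 : r2 1 = r 1 by rewrite fr.
have -> : (missed m 0 (r 8) (r 0) < r 4) = (0 < r2 10).
  by rewrite r210 subn_gt0.
case b: (r2 10) => [|v].
  exists (6 + (q + 3)); eexists; split; first by lia.
  - rewrite iterD iterD start run /= /ram_step /= /upd /= b /= r2_13 /= /upd /=.
    by rewrite r2_1 r2_7 pc b.
  - by split; rewrite /upd //= ?r2_1 ?r2_7.
  - by move=> i; rewrite !inE => /or3P[] /eqP ->; rewrite /upd /= fr.
exists (5 + (q + 3)); eexists; split; first by lia.
- rewrite iterD iterD start run /= /ram_step /= /upd /= b /= /upd /=.
  by rewrite r2_1 r2_7 r2_13 pc.
- by split; rewrite /upd //= ?r2_1 ?r2_7.
- by move=> i; rewrite !inE => /or3P[] /eqP ->; rewrite /upd /= fr.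
Qed.

Lemma eq_missed (m m' : nat -> nat) (a b c h : nat) :
  (a + c <= h) -> (b + c <= h) -> (forall i, (i < h) -> m i = m' i) ->
  missed m a b c = missed m' a b c.
Proof.
move=> ah bh mm'; apply: eq_bigr => i _; have := ltn_ord i.
by move=> ic; rewrite !mm' //; lia.
Qed.

(** The two address inequalities put the output buffer above y and above all columns still to be
    read, so writing bits never disturbs the input. *)
Lemma matrix_loop (c : nat) (r m : nat -> nat) :
  r 13 = 1 -> (0 < r 0) -> r 1 = c.+1 ->
  (r 0 <= r 8) -> (r 8 + c.+1 * r 0 <= r 7) ->
  exists q r' m', [/\ (q <= c.+1 * (9 * r 0 + 9)),
    iter q step (RamState 3 r m) = RamState 23 r' m',
    (forall a, (a < r 7) -> m' a = m a) &
    forall j, (j < c.+1) ->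
      m' (r 7 + j) = (missed m 0 (r 8 + j * r 0) (r 0) < r 4)].
Proof.
elim: c r m => [|c IH] r m r13 r0 r1 r08 r87;
  have [q [r' [qle run [r'1 r'7 r'8] fr]]] := column_step m r13 r0;
  rewrite r1 /= in run r'1.
  exists q, r', (upd m (r 7) (missed m 0 (r 8) (r 0) < r 4)); split=> //.
  - by rewrite mul1n.
  - by move=> a ar; rewrite /upd ltn_eqF.
  - by case=> // _; rewrite !addn0 /upd eqxx.
have r'0 : r' 0 = r 0 by rewrite fr.
have r'4 : r' 4 = r 4 by rewrite fr.
set m1 := upd m _ _ in run.
have m1E a : (a < r 7) -> m1 a = m a by move=> ar; rewrite /m1 /upd ltn_eqF.
have r'13 : r' 13 = 1 by rewrite fr.
have [] := IH r' m1; rewrite ?r'0 ?r'8 ?r'7 //; try lia.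
move=> q' [r2 [m2 [q'le run' m2lo m2hi]]].
exists (q' + q), r2, m2; split.
- by rewrite mulSn addnC leq_add.
- by rewrite iterD run.
- by move=> a ar; rewrite m2lo ?m1E //; lia.
case=> [_|j jc].
  by rewrite !addn0 m2lo // /m1 /upd eqxx.

(* Column [j.+1] is column [j] of the remaining ones; the bit just written at [r 7] lies above every
   cell that they read. *)
rewrite addnS -addSn m2hi // r'4; congr (nat_of_bool (_ < _)).
rewrite (@eq_missed m1 m _ _ _ (r 7)) //; try nia.
by rewrite mulSn addnA.
Qed.

Lemma nth_allpairs (S T U : Type) (f : S -> T -> U) x0 y0 u0
    (s : seq S) (t : seq T) (a b : nat) : a < size s -> b < size t ->
  nth u0 [seq f x y | x <- s, y <- t] (a * size t + b) =
  f (nth x0 s a) (nth y0 t b).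
Proof.
elim: s a => // x s IH [|a] /= als blt; rewrite nth_cat size_map.
  by rewrite mul0n add0n blt (nth_map y0).
by rewrite mulSn -addnA ltnNge leq_addr /= addKn IH.
Qed.

End ThresholdProgram.

(** * The threshold decoder and its implementation *)

Definition threshold_decode (R : realType) (M N : nat) (A : 'M['F_2]_(M, N))
    (e : R) (y : 'rV['F_2]_M) : 'rV['F_2]_N :=
  \row_j (#|[set i | (A i j != 0) && (y 0 i == 0)]|%:R <= e)%R%:R.

(** y fills the first [M] cells, so column [j] starts at [M + j * M]. *)
Lemma missed_decoder_input (R : realType) (M N : nat) (A : 'M['F_2]_(M, N))
    (D : nat) (e0 e1 e0' e1' : R) (y : 'rV['F_2]_M) (j : 'I_N) :
  missed (ram_mem (decoder_input A D e0 e1 e0' e1' y)) 0 (M + j * M) M =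
  #|[set i | (A i j != 0) && (y 0 i == 0)]|.
Proof.
rewrite -sum1_card [RHS]big_mkcond; apply: eq_bigr => i _.
rewrite inE add0n /= -addnA !nth_cat size_map size_enum_ord ltn_ord.
rewrite ltnNge leq_addr /= addKn (nth_map i) ?size_enum_ord // nth_ord_enum.
rewrite -[X in (_ * X)%N](size_enum_ord M).
rewrite (nth_allpairs _ j i) ?size_enum_ord //.
by rewrite !nth_ord_enum andbC -!val_eqE; case: ifP.
Qed.

Lemma threshold_program_correct (R : realType) (M N : nat)
    (A : 'M['F_2]_(M, N)) (D : nat) (e0 e1 e0' e1' : R) (y : 'rV['F_2]_M) :
  (0 < M)%N -> (0 < N)%N -> 0 <= e1 ->
  outputs_within threshold_program (decoder_input A D e0 e1 e0' e1' y)
    (21 * (M * N)) M (threshold_decode A e1 y).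
Proof.
case: N A => // N A M0 _ e1_ge0.
set s0 := decoder_input _ _ _ _ _ _ _.
(* Registers after the first three instructions. The budget is one more than the threshold, so that
   exactly [Num.truncn e1] misses still leave it positive. *)
pose r := upd (upd (upd (ram_reg s0) 13 1) 4 (Num.truncn e1).+1) 8 M.
have start : iter 3 step s0 = RamState 3 r (ram_mem s0) by [].
have [] := @matrix_loop N r (ram_mem s0); rewrite ?/r //=.
  by rewrite /upd /= /out_addr mulnC.
rewrite -/r => q [r' [m' [qle run _ m'E]]].
exists (q + 3)%N.
  have {}qle : (q <= N.+1 * (9 * M + 9))%N by [].
  (* Both dimensions are at least 1, so the 3 initial steps cost at most 3 MN and the loop at most
     18 MN, whence the constant 21. *)
  by have := leq_pmull N.+1 M0; nia.
rewrite iterD start run; split=> // j /=.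
have cnt : missed (ram_mem s0) 0 (r 8 + j * r 0%N) (r 0%N) = _ :=
  missed_decoder_input A D e0 e1 e0' e1' y j.
have r4 : r 4%N = (Num.truncn e1).+1 by [].
(* As [e1] is nonnegative, an integer count is at most [Num.truncn e1] iff it is at most [e1]. *)
rewrite [LHS](m'E j (ltn_ord j)) cnt r4 ltnS truncn_ge_nat // mxE.
by case: (_ <= _).
Qed.

(** * Bits, finite sets and label bijections *)

Lemma F2_neq0 (x : 'F_2) : (x != 0) = (x == 1).
Proof. by case: x => [[|[|]]]. Qed.

Lemma F2_nat_eq0 (b : bool) : (b%:R == 0 :> 'F_2) = ~~ b.
Proof. by case: b. Qed.

(** When [J] already has [K] elements, truncated subtraction makes the last bound 0: nothing is
    added. *)
Lemma exists_superset_card (T : finType) (J : {set T}) (K : nat) :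
  (K <= #|T|)%N ->
  exists J' : {set T}, [/\ J \subset J', (K <= #|J'|)%N &
    (#|J' :\: J| <= K - #|J|)%N].
Proof.
move=> KT; pose s := take (K - #|J|) (enum (~: J)).
have ss : (size s = K - #|J|)%N.
  by rewrite size_takel // -cardE; have := cardsC J; lia.
have us : #|[set x in s]| = size s.
  by rewrite cardsE; apply/card_uniqP/take_uniq/enum_uniq.
have dis : [disjoint J & [set x in s]].
  rewrite disjoint_subset; apply/fintype.subsetP => x xJ; rewrite !inE.
  by apply/negP => /mem_take; rewrite mem_enum inE xJ.
exists (J :|: [set x in s]); split; first exact: finset.subsetUl.
- by rewrite cardsU disjoint_setI0 // cards0 us ss; lia.
- rewrite finset.setDUl finset.setDv finset.set0U -ss -us.
  by apply: subset_leq_card; exact: finset.subsetDl.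
Qed.

Lemma card_bigcup_le (T I : finType) (J : {set I}) (F : I -> {set T})
    (c : nat) :
  (forall j, #|F j| <= c)%N -> (#|\bigcup_(j in J) F j| <= #|J| * c)%N.
Proof.
move=> Fc; rewrite -sum_nat_const.
elim/big_rec2: _ => [|j m U _ Um]; first by rewrite cards0.
by apply: leq_trans (leq_card_setU _ _) (leq_add (Fc j) Um).
Qed.

Lemma row_label_inj t l : injective (@row_label t l).
Proof. by move=> r r' /enum_val_inj /cast_ord_inj. Qed.

Lemma row_label_surj t l u : exists r, @row_label t l r = u.
Proof.
exists (cast_ord (card_F2vec_pair t l) (enum_rank u)).
by rewrite /row_label cast_ordK enum_rankK.
Qed.

Lemma col_label_inj n : injective (@col_label n).
Proof. by move=> r r' /enum_val_inj /cast_ord_inj. Qed.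

Lemma or_mx_neq0 (M N : nat) (A : 'M['F_2]_(M, N)) x i :
  (or_mx A x 0 i != 0) = [exists j, (x 0 j != 0) && (A i j != 0)].
Proof. by rewrite mxE F2_nat_eq0 negbK. Qed.

(** * Validity of threshold decoding for codeword graphs *)

Section CodewordMatrix.
Variables (n t l : nat) (f : 'rV['F_2]_n -> 'rV['F_2]_t -> 'rV['F_2]_l).
Local Notation A := (codeword_mx f).

Lemma codeword_mx_neq0 r c :
  (A r c != 0) = (f (col_label c) (row_label r).1 == (row_label r).2).
Proof. by rewrite mxE F2_nat_eq0 negbK. Qed.

(** A column has a single one per seed, so projecting its ones to seeds is injective. *)
Lemma card_codeword_col c : (#|[set r | (A r c != 0)%R]| <= 2 ^ t)%N.
Proof.
rewrite -[leqRHS]card_F2vec -(@card_in_imset _ _ (fun r => (row_label r).1)).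
  exact: max_card.
move=> r r'; rewrite !inE !codeword_mx_neq0 => /eqP rE /eqP r'E e.
apply: row_label_inj; rewrite [LHS]surjective_pairing [RHS]surjective_pairing.
by rewrite -rE -r'E e.
Qed.

Lemma card_codeword_missed c (B : {set 'I_(2 ^ t * 2 ^ l)}) :
  (#|[set i | (i, f (col_label c) i) \notin @row_label t l @: B]| <=
   #|[set r | (A r c != 0)%R && (r \notin B)]|)%N.
Proof.
apply: leq_trans (leq_imset_card (fun r => (row_label r).1) _).
apply: subset_leq_card; apply/fintype.subsetP => i; rewrite inE => iB.
have [r rE] := row_label_surj (i, f (col_label c) i).
apply/finset.imsetP; exists r; last by rewrite rE.
rewrite inE codeword_mx_neq0 rE eqxx /=; apply: contra iB => rB.
by rewrite -rE imset_f.
Qed.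

Context {R : realType}.

(** Here [delta] stands for nu / gamma: a column is kept when it misses y on at most a [delta]
    fraction of the seeds, the form that [condenser_test] needs. *)
Lemma threshold_decode_valid (k k' : nat) (eps p delta : R) (D : nat)
    (y : 'rV['F_2]_(2 ^ t * 2 ^ l)) :
  strong_condenser k k' eps f -> (k <= n)%N -> 0 <= delta ->
  (p * (2 ^ l)%:R + D%:R) / (2 ^ k')%:R + delta < 1 - eps ->
  valid_decoding A D (p * (2 ^ t * 2 ^ l)%:R) (delta * (2 ^ t)%:R)
    ((2 ^ k)%:R - D%:R) 0 y (threshold_decode A (delta * (2 ^ t)%:R) y).
Proof.
move=> fC kn delta0 par x xD far [close0 close1]; apply: far.
set e1 := delta * _ in close1 *; set z := threshold_decode _ _ _.
pose miss j := [set i | (A i j != 0) && (y 0 i == 0)].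
have zE j : z 0 j = (#|miss j|%:R <= e1)%R%:R by rewrite mxE.
pose J := [set j | z 0 j != 0]; pose X := [set j | x 0 j != 0].
(* The ones of a column of [X] are ones of A[x], so those facing zeros of y are among the flips
   counted by [close1]. *)
have XJ : X \subset J.
  apply/fintype.subsetP => j; rewrite !inE zE F2_nat_eq0 negbK => xj.
  apply: le_trans close1; rewrite ler_nat; apply: subset_leq_card.
  apply/fintype.subsetP => i; rewrite !inE -F2_neq0 or_mx_neq0.
  by case/andP=> Aij ->; rewrite andbT; apply/fintype.existsP; exists j;
    rewrite xj.
split; last first.
  rewrite (_ : [set _ | _] = finset.set0) ?cards0 //.
  apply/finset.setP => j; rewrite !inE.
  apply/negbTE/negP => /andP[]; rewrite -F2_neq0 => xj /eqP zj.
  by have /(fintype.subsetP XJ) : j \in X; rewrite inE // zj eqxx.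
have -> : [set j | (x 0 j == 0) && (z 0 j == 1)] = J :\: X.
  by apply/finset.setP => j; rewrite !inE negbK -F2_neq0.
rewrite leNgt; apply/negP => manyJ.
have [J' [JJ' kJ' J'J]] : exists J' : {set 'I_(2 ^ n)}, [/\ J \subset J',
    (2 ^ k <= #|J'|)%N & (#|J' :\: J| <= 2 ^ k - #|J|)%N].
  by apply: exists_superset_card; rewrite card_ord leq_exp2l.
(* If [J] has at least K elements, there is no padding and sparsity suffices. Otherwise the padding
   is at most K - |J|, and [manyJ] gives |J| - |X| > K - D. *)
have XD : (#|X| + #|J' :\: J| <= D)%N.
  rewrite ltrBlDr -natrD ltr_nat cardsDS // in manyJ.
  by have := subset_leq_card XJ; rewrite /sparse -/X in xD; lia.
pose E := [set i | (or_mx A x 0 i == 0) && (y 0 i == 1)].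
pose B := E :|: \bigcup_(j in X :|: (J' :\: J)) [set r | A r j != 0].
(* [E] has at most p M elements, and each of at most [D] columns adds at most [2 ^ t] ones. *)
have cardB : #|B|%:R <= (p * (2 ^ l)%:R + D%:R) * (2 ^ t)%:R :> R.
  apply: le_trans (_ : (#|E| + D * 2 ^ t)%:R <= _).
    rewrite ler_nat; apply: leq_trans (leq_card_setU _ _) _.
    rewrite leq_add2l; apply: leq_trans (card_bigcup_le _ card_codeword_col) _.
    by rewrite leq_mul2r (leq_trans (leq_card_setU _ _)) ?orbT.
  rewrite natrD mulrDl natrM lerD2r; apply: le_trans close0 _.
  by rewrite natrM mulrAC mulrA.
have yB r : y 0 r != 0 -> r \in B.
  move=> yr; have [x0r|] := eqVneq (or_mx A x 0 r) 0.
    by rewrite inE; apply/orP; left; rewrite inE x0r eqxx -F2_neq0.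
  rewrite or_mx_neq0 => /fintype.existsP[j /andP[xj Arj]].
  rewrite inE; apply/orP; right; apply/finset.bigcupP.
  exists j; rewrite !inE //.
  by rewrite xj.
(* For a column of [J], ones outside [B] face zeros of y by [yB]; all ones of a padding column lie
   in [B]. *)
have missJ' j : j \in J' -> #|[set r | (A r j != 0) && (r \notin B)]|%:R <= e1.
  move=> jJ'; have [jJ|jJ] := boolP (j \in J).
    have : #|miss j|%:R <= e1 by move: jJ; rewrite inE zE F2_nat_eq0 negbK.
    apply: le_trans; rewrite ler_nat; apply: subset_leq_card.
    apply/fintype.subsetP => r; rewrite inE => /andP[Arj rB]; rewrite inE Arj.
    by apply: contraR rB => /yB.
  rewrite (_ : [set _ | _] = finset.set0) ?cards0 ?mulr_ge0 //.
  apply/finset.setP => r; rewrite !inE; apply/negbTE/negP.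
  move=> /andP[Arj] /norP[_] /negP.
  apply; apply/finset.bigcupP; exists j; last by rewrite inE.
  by rewrite finset.in_setU finset.in_setD jJ jJ' orbT.
have := @condenser_test R n t l k k' eps delta f (@col_label n @: J')
  (@row_label t l @: B) fC.
rewrite card_imset; last exact: col_label_inj.
rewrite card_imset; last exact: row_label_inj.
move=> /(_ kJ') test.
suff : 1 - delta - #|B|%:R / (2 ^ t * 2 ^ k')%:R <= eps.
  have T0 : 0 < (2 ^ t)%:R :> R by rewrite ltr0n expn_gt0.
  have K0 : 0 < (2 ^ k')%:R :> R by rewrite ltr0n expn_gt0.
  have : #|B|%:R / (2 ^ t * 2 ^ k')%:R <= (p * (2 ^ l)%:R + D%:R) / (2 ^ k')%:R.
    rewrite natrM invfM mulrA ler_pM2r ?invr_gt0 //.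
    by rewrite ler_pdivrMr.
  by move: par; lra.
apply: test => _ /finset.imsetP[j jJ' ->].
by apply: le_trans (missJ' j jJ'); rewrite ler_nat card_codeword_missed.
Qed.

End CodewordMatrix.

(** * Error correction with decoding in time O(MN) *)

Theorem theorem2 (R : realType) :
  exists (P : ram_program) (C : nat),
  forall (n t l k k' : nat) (eps : R)
    (f : 'rV['F_2]_n -> 'rV['F_2]_t -> 'rV['F_2]_l)
    (p nu gamma : R) (D : nat),
  let K := (2 ^ k)%N in
  let K' := (2 ^ k')%N in
  let L := (2 ^ l)%N in
  let N := (2 ^ n)%N in
  let T := (2 ^ t)%N in
  let M := (T * L)%N in
  (0 < n)%N -> (0 < t)%N -> (0 < l)%N -> (k <= n)%N -> 0 <= eps ->
  strong_condenser k k' eps f ->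
  0 < p -> 0 < nu -> 0 < gamma ->
  (p + gamma) * (L%:R / K'%:R) + nu / gamma < 1 - eps ->
  D%:R = gamma * L%:R ->
  let A : 'M['F_2]_(M, N) := codeword_mx f in
  let e0 := p * M%:R in
  let e1 := nu / D%:R * M%:R in
  let e0' := K%:R - D%:R in
  let e1' := 0 in
  correcting A D e0 e1 e0' e1' /\
  forall y : 'rV['F_2]_M, exists2 z : 'rV['F_2]_N,
    valid_decoding A D e0 e1 e0' e1' y z &
    outputs_within P (decoder_input A D e0 e1 e0' e1' y) (C * (M * N)) M z.
Proof.
exists threshold_program, 21%N => n t l k k' eps f p nu gamma D K K' L N T M.
move=> _ _ _ kn _ fC _ nu0 gamma0 par DE A e0 e1 e0' e1'.
have L0 : L%:R != 0 :> R by rewrite pnatr_eq0 expn_eq0.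
have delta0 : 0 <= nu / gamma by rewrite divr_ge0 // ltW.
(* Since D = gamma L and M = T L, the factor L cancels. *)
have e1E : e1 = nu / gamma * T%:R.
  rewrite /e1 DE natrM invfM [nu * _]mulrA -[LHS]mulrA; congr (_ * _).
  by rewrite mulrCA mulVf // mulr1.
have valid y : valid_decoding A D e0 e1 e0' e1' y (threshold_decode A e1 y).
  rewrite e1E; apply: threshold_decode_valid fC kn delta0 _.
  by rewrite DE -mulrDl -mulrA.
split=> y; exists (threshold_decode A e1 y) => //.
apply: threshold_program_correct; rewrite ?muln_gt0 ?expn_gt0 //.
by rewrite e1E mulr_ge0.
Qed.
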